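(* For every $\epsilon\ge0$ and $c(m)>0$ the following holds. If there is a $(1-\epsilon)$-approximately truthful-in-expectation mechanism $\mathcal{M}$ for the (exact or flexible) combinatorial public projects problem that achieves a $c(m)$-approximation for submodular valuations on $m$ elements, then for any $\delta>0$ there is a non-uniform $(1-3\epsilon-\delta)$-approximately maximal-in-distributional-range mechanism $\mathcal{M}'$ (for the same variant of the problem) that achieves a $c(m)$-approximation for submodular valuations on $m$ elements and uses at most $m$ more value queries than $\mathcal{M}$.
   Context: Combinatorial public projects (CPP): there is a set $[m]$ of projects, a cardinality bound $0\le k\le m$, and players $i=1,\dots,n$ with valuations $v_i:2^{[m]}\to\mathbb{R}_+$ that are normalized ($v_i(\emptyset)=0$), monotone and submodular, accessible through value queries $S\mapsto v_i(S)$. The set of outcomes is $\Omega=\{S\subseteq[m]:|S|\le k\}$ in the flexible variant and $\Omega=\{S\subseteq[m]:|S|=k\}$ in the exact variant. The goal is to choose $S\in\Omega$ maximizing the social welfare $\sum_i v_i(S)$. A (randomized) mechanism consists of an allocation rule $\mathcal{A}$, mapping reported valuations $v$ to a random outcome $\mathcal{A}(v)\in\Omega$, and a payment rule $p$, mapping reported valuations to random payments $p_i(v)$; it is assumed individually rational in expectation ($\mathbf{E}[v_i(\mathcal{A}(v))-p_i(v)]\ge 0$) with non-negative expected payments ($\mathbf{E}[p_i(v)]\ge0$). It is $(1-\epsilon)$-approximately truthful-in-expectation if for every $i$, $v_i$, $v'_i$, $v_{-i}$: $\mathbf{E}[v_i(\mathcal{A}(v))-p_i(v)]\ge(1-\epsilon)\mathbf{E}[v_i(\mathcal{A}(v'_i,v_{-i}))-p_i(v'_i,v_{-i})]$.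 An allocation rule is $(1-\eta)$-approximately maximal-in-distributional-range if there is a set $\mathcal{R}$ of probability distributions over $\Omega$, fixed independently of the valuations, such that on every input the outcome is sampled from some $D^*\in\mathcal{R}$ with $\mathbf{E}_{S\sim D^*}[\sum_iv_i(S)]\ge(1-\eta)\sup_{D\in\mathcal{R}}\mathbf{E}_{S\sim D}[\sum_iv_i(S)]$. A $c$-approximation means that on every input the expected social welfare is at least $c$ times the maximum over $\Omega$. A non-uniform mechanism is a separate fixed mechanism for each input size $m$, whose description may depend arbitrarily on $m$ (its only relevant resource is the number of value queries). Convention: since the welfare depends only on $v=\sum_iv_i$, which is again a normalized monotone submodular valuation, the $n$-player allocation problem is identified with the single-player problem with valuation $v$; the comparison of numbers of value queries refers to the single-player problem (queries to the single valuation $v$), $\mathcal{M}$ being restricted to the case of one player. *)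

(* Defs.v *)
From HB Require Import structures.
From mathcomp Require Export all_boot all_order all_algebra.
From mathcomp Require Export all_classical all_reals all_analysis.

Set Implicit Arguments.
Unset Strict Implicit.
Unset Printing Implicit Defensive.

Import Order.TTheory GRing.Theory Num.Theory.
Local Open Scope classical_set_scope.
Local Open Scope ring_scope.

Inductive variant := Exact | Flexible.

(* The set of outcomes Omega. *)
Definition outcomes (b : variant) (m k : nat) : {set {set 'I_m}} :=
  match b with
  | Exact => [set S : {set 'I_m} | #|S| == k]%SET
  | Flexible => [set S : {set 'I_m} | (#|S| <= k)%N]%SET
  end.

Section Valuations.
Context {R : realType}.

Record submodular_valuation (m : nat) (v : {set 'I_m} -> R) : Prop := {
  valuation_ge0 : forall A, 0 <= v A;
  valuation_normalized : v finset.set0 = 0;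
  valuation_monotone : forall A B : {set 'I_m}, A \subset B -> v A <= v B;
  valuation_submodular : forall A B : {set 'I_m},
    v (A :|: B)%SET + v (A :&: B)%SET <= v A + v B }.

Definition profile (n m : nat) := 'I_n -> {set 'I_m} -> R.

Definition valid_profile n m (v : profile n m) : Prop :=
  forall i, submodular_valuation (v i).

Definition deviate n m (v : profile n m) (i : 'I_n) (w : {set 'I_m} -> R) :
  profile n m := fun j => if j == i then w else v j.

Definition welfare n m (v : profile n m) (S : {set 'I_m}) : R :=
  \sum_(i < n) v i S.

(* The default 0 of the maximum is harmless: the welfare of a valid profile
   is non-negative, and there is an outcome as soon as k <= m. *)
Definition opt_welfare (b : variant) n m (k : nat) (v : profile n m) : R :=
  \big[Num.max/0]_(S in outcomes b m k) welfare v S.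

End Valuations.

Arguments profile : clear implicits.

(* A deterministic adaptive algorithm with output in X: [Query i S f] asks for
   the value v_i(S) and continues with f applied to the answer. *)
Inductive query_algo (R : realType) (n m : nat) (X : Type) : Type :=
  | Return (x : X)
  | Query (i : 'I_n) (S : {set 'I_m}) (f : R -> query_algo R n m X).

Fixpoint run (R : realType) n m X (t : query_algo R n m X)
    (v : profile R n m) : X :=
  match t with
  | Return x => x
  | Query i A f => run (f (v i A)) v
  end.

Fixpoint nqueries (R : realType) n m X (t : query_algo R n m X)
    (v : profile R n m) : nat :=
  match t with
  | Return _ => 0%N
  | Query i A f => (nqueries (f (v i A)) v).+1
  end.

(* A randomized value-query mechanism tosses all its coins beforehand, in an
   arbitrary probability space; each coin fixes a deterministic query algorithm
   that computes the outcome and the payments. *)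
Record mechanism (R : realType) (n m : nat) := Mechanism {
  coin_display : measure_display;
  coins : measurableType coin_display;
  coin_law : probability coins R;
  algo : coins -> query_algo R n m ({set 'I_m} * ('I_n -> R)) }.

Section Mechanisms.
Context {R : realType}.

Definition alloc n m (M : mechanism R n m) (v : profile R n m)
  (w : coins M) : {set 'I_m} := (run (algo w) v).1.

Definition payment n m (M : mechanism R n m) (v : profile R n m) (i : 'I_n)
  (w : coins M) : R := (run (algo w) v).2 i.

(* E[u(A(v)) - p_i(v)], where u is the true valuation of player i and v the
   reported profile. *)
Definition expected_utility n m (M : mechanism R n m) (u : {set 'I_m} -> R)
    (v : profile R n m) (i : 'I_n) : \bar R :=
  'E_(coin_law M)[fun w : coins M => u (alloc v w) - payment v i w].

(* The first three fields say that A(v) is a random element of Omega and that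
   the payments are random variables with an expectation. *)
Record mechanism_ok (b : variant) n m (k : nat) (M : mechanism R n m) :
    Prop := {
  alloc_feasible : forall v, valid_profile v ->
    forall w : coins M, alloc v w \in outcomes b m k;
  alloc_measurable : forall v, valid_profile v ->
    forall S, measurable [set w : coins M | alloc v w = S];
  payment_integrable : forall v, valid_profile v ->
    forall i, (coin_law M).-integrable setT (EFin \o @payment _ _ M v i);
  individually_rational : forall v, valid_profile v ->
    forall i, (0 <= expected_utility M (v i) v i)%E;
  payment_ge0 : forall v, valid_profile v ->
    forall i, (0 <= 'E_(coin_law M)[@payment _ _ M v i])%E }.

Definition approx_truthful n m (eps : R) (M : mechanism R n m) : Prop :=
  forall (v : profile R n m) (i : 'I_n) (v'i : {set 'I_m} -> R),
    valid_profile v -> submodular_valuation v'i ->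
    ((1 - eps)%:E * expected_utility M (v i) (deviate v i v'i) i
      <= expected_utility M (v i) v i)%E.

Definition approximates (b : variant) n m (k : nat) (c : R)
    (M : mechanism R n m) : Prop :=
  forall v, valid_profile v ->
    ((c * opt_welfare b k v)%:E
      <= 'E_(coin_law M)[fun w : coins M => welfare v (alloc v w)])%E.

Record distribution_on m (Om : {set {set 'I_m}}) (D : {set 'I_m} -> R) :
    Prop := {
  distribution_ge0 : forall S, 0 <= D S;
  distribution_sum1 : \sum_S D S = 1;
  distribution_supp : forall S, S \notin Om -> D S = 0 }.

Definition expected_welfare n m (v : profile R n m) (D : {set 'I_m} -> R) : R :=
  \sum_S D S * welfare v S.

(* [M n] handles n players. The range may depend neither on the valuations nor
   on the number of players. *)
Definition approx_midr (b : variant) m (k : nat) (eta : R)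
    (M : forall n, mechanism R n m) : Prop :=
  exists Rng : set ({set 'I_m} -> R),
    (forall D, Rng D -> distribution_on (outcomes b m k) D) /\
    forall n (v : profile R n m), (0 < n)%N -> valid_profile v ->
      exists D, [/\ Rng D,
        forall S, coin_law (M n) [set w : coins (M n) | alloc v w = S]
                  = (D S)%:E
      & (1 - eta) * sup [set expected_welfare v D' | D' in Rng]
          <= expected_welfare v D].

(* Worst case over the valuations and the coins. *)
Definition queries_at_most n m (M : mechanism R n m) (q : nat) : Prop :=
  forall v, valid_profile v ->
    forall w : coins M, (nqueries (algo w) v <= q)%N.

End Mechanisms.

(* Main.v *)
(* Identify a profile with its welfare function v and look at the menu of the
   one-player mechanism M: the pairs (lottery, expected price) over all reports.
   Up to a small error the lotteries take finitely many values, since the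
   simplex is totally bounded, so a finite part of the menu, with prices at most
   some B, approximates all of it.  The mechanism M' charges nothing and runs M
   on the report u = (lambda / s) v, where s = sum_j v({j}) costs m queries and
   lambda, depending on m and k only, is large compared with B.  In the utility
   of u the prices of the finite part are negligible, so by approximate
   truthfulness the lottery sold to u is almost optimal for v in the whole menu,
   up to a factor 1 - eps and an additive error of order s.  That error is
   absorbed in the factor because s <= m * max welfare <= (m / c) * E[welfare].
   The range of M' is the set of all lotteries in the menu. *)
Require Import Defs.
From mathcomp Require Import all_boot all_order all_algebra.
From mathcomp Require Import all_classical all_reals all_analysis.
From mathcomp Require Import ring lra.
Import Order.TTheory GRing.Theory Num.Theory.
Local Open Scope ring_scope.

Set Implicit Arguments.
Unset Strict Implicit.
Unset Printing Implicit Defensive.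

(** * Random variables with values in a finite type *)

Lemma finite_rv_indicE (R : realType) (Om : Type) (T : finType) (X : Om -> T)
    (f : T -> R) :
  EFin \o (f \o X) =
  (fun w => \sum_(t : T) (f t)%:E * (\1_([set w' | X w' = t]%classic) w)%:E)%E.
Proof.
apply/funext => w /=.
rewrite (bigD1 (X w)) //= indicE mem_set // mule1 big1 ?adde0 //.
by move=> t /eqP ntX; rewrite indicE memNset ?mule0 // => /esym.
Qed.

Lemma integrable_finite_rv (R : realType) (d : measure_display)
    (Om : measurableType d) (P : probability Om R) (T : finType) (X : Om -> T)
    (mX : forall t, measurable [set w | X w = t]%classic) (f : T -> R) :
  P.-integrable setT (EFin \o (f \o X)).
Proof.
rewrite finite_rv_indicE; apply: integrable_sum => // t _.
apply: integrableZl => //; exact: integrable_indic.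
Qed.

Lemma expectation_finite_rv (R : realType) (d : measure_display)
    (Om : measurableType d) (P : probability Om R) (T : finType) (X : Om -> T)
    (mX : forall t, measurable [set w | X w = t]%classic) (f : T -> R) :
  ('E_P[f \o X] =
    (\sum_(t : T) fine (P [set w | X w = t]%classic) * f t)%R%:E)%E.
Proof.
rewrite unlock -[X in integral _ _ X]/(EFin \o (f \o X)) finite_rv_indicE.
rewrite integral_sum //; last first.
  move=> t; apply: integrableZl => //; exact: integrable_indic.
rewrite -sumEFin; apply: eq_bigr => t _.
rewrite integralZl //; last exact: integrable_indic.
by rewrite integral_indic // setIT EFinM fineK ?fin_num_measure // muleC.
Qed.

(** * Closure properties and subadditivity of submodular valuations *)

Lemma submodular_valuationZ (R : realType) (m : nat) (a : R)
    (v : {set 'I_m} -> R) :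
  0 <= a -> submodular_valuation v -> submodular_valuation (fun S => a * v S).
Proof.
move=> a0 [v0 vn vm vs]; split.
- by move=> A; rewrite mulr_ge0.
- by rewrite vn mulr0.
- by move=> A B AB; rewrite ler_wpM2l ?vm.
- by move=> A B; rewrite -!mulrDr ler_wpM2l ?vs.
Qed.

Lemma submodular_welfare (R : realType) (n m : nat) (v : profile R n m) :
  valid_profile v -> submodular_valuation (welfare v).
Proof.
move=> hv; split.
- by move=> A; apply: sumr_ge0 => i _; exact: valuation_ge0.
- by apply: big1 => i _; exact: valuation_normalized.
- by move=> A B AB; apply: ler_sum => i _; exact: valuation_monotone.
- move=> A B; rewrite /welfare -!big_split /=; apply: ler_sum => i _.
  exact: valuation_submodular.
Qed.

(** Subadditivity: elements are split off one at a time by submodularity, and the non-negative value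
    of the intersection is dropped. *)
Lemma valuation_le_singletons (R : realType) (m : nat) (v : {set 'I_m} -> R) S :
  submodular_valuation v -> v S <= \sum_(j : 'I_m) v [set j]%SET.
Proof.
move=> hv; apply: (@le_trans _ _ (\sum_(j in S) v [set j]%SET)); last first.
  rewrite [leRHS](bigID (mem S)) /= lerDl.
  by apply: sumr_ge0 => j _; exact: valuation_ge0.
have [N] := ubnP #|S|; elim: N S => // N IH S.
have [->|[j jS]] := set_0Vmem S.
  by rewrite big_set0 (valuation_normalized hv).
rewrite (cardsD1 j) jS ltnS => /IH le_tl.
rewrite (big_setD1 j) //= -{1}(finset.setD1K jS).
apply: le_trans _ (lerD (lexx _) le_tl).
apply: le_trans _ (valuation_submodular hv _ _).
by rewrite lerDl; exact: valuation_ge0.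
Qed.

(** * Answering one-player queries from an [n]-player profile *)

(** Continuation-passing style lets the sum of the answers determine the algorithm that follows. *)
Fixpoint ask_sum (R : realType) n m X (s : seq ('I_n * {set 'I_m})) (acc : R)
    (f : R -> query_algo R n m X) : query_algo R n m X :=
  match s with
  | [::] => f acc
  | q :: s' => Query q.1 q.2 (fun r => ask_sum s' (acc + r) f)
  end.

Lemma run_ask_sum (R : realType) n m X s acc (f : R -> query_algo R n m X) v :
  run (ask_sum s acc f) v = run (f (acc + \sum_(q <- s) v q.1 q.2)) v.
Proof.
elim: s acc => [|q s IH] acc /=; first by rewrite big_nil addr0.
by rewrite IH big_cons addrA.
Qed.

Lemma nqueries_ask_sum (R : realType) n m X s acc
    (f : R -> query_algo R n m X) v :
  nqueries (ask_sum s acc f) v =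
  (size s + nqueries (f (acc + \sum_(q <- s) v q.1 q.2)%R) v)%N.
Proof.
elim: s acc => [|q s IH] acc /=; first by rewrite big_nil addr0.
by rewrite IH big_cons addrA addSn.
Qed.

Definition single (R : realType) m (v : {set 'I_m} -> R) : profile R 1 m :=
  fun=> v.

Lemma valid_single (R : realType) m (v : {set 'I_m} -> R) :
  submodular_valuation v -> valid_profile (single v).
Proof. by move=> hv i. Qed.

(** A query to the single valuation is answered by [a] times the welfare, at the cost of one query
    per player, hence at no extra cost when [n = 1]. The map [g] serves to discard the payments. *)
Fixpoint simulate (R : realType) n m X Y (a : R) (g : X -> Y)
    (t : query_algo R 1 m X) : query_algo R n m Y :=
  match t with
  | Return x => Return _ _ _ (g x)
  | Query _ A f => ask_sum [seq (i, A) | i <- enum 'I_n] 0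
                     (fun r => simulate n a g (f (a * r)))
  end.

Lemma run_simulate (R : realType) n m X Y (a : R) (g : X -> Y)
    (t : query_algo R 1 m X) (v : profile R n m) :
  run (simulate n a g t) v = g (run t (single (fun S => a * welfare v S))).
Proof.
elim: t => [x|i S f IH] //=.
by rewrite run_ask_sum IH add0r big_map big_enum.
Qed.

Lemma nqueries_simulate (R : realType) m X Y (a : R) (g : X -> Y)
    (t : query_algo R 1 m X) (v : profile R 1 m) :
  nqueries (simulate 1 a g t) v =
  nqueries t (single (fun S => a * welfare v S)).
Proof.
elim: t => [x|i S f IH] //=.
by rewrite nqueries_ask_sum IH add0r big_map big_enum size_map size_enum_ord.
Qed.

(** * The mechanism that runs [M] on the rescaled welfare *)

Definition singletons n m : seq ('I_n * {set 'I_m}) :=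
  [seq (i, [set j]%SET) | i <- enum 'I_n, j <- enum 'I_m].

Definition scale (R : realType) n m (v : profile R n m) : R :=
  \sum_(j : 'I_m) welfare v [set j]%SET.

(* If [scale v = 0] then [v = 0], and the junk value [lam / 0 = 0] reports the
   zero valuation, so that case needs no separate branch in the mechanism. *)
Definition scaled (R : realType) n m (lam : R) (v : profile R n m)
  (S : {set 'I_m}) : R := lam / scale v * welfare v S.

Lemma scale_ge0 (R : realType) n m (v : profile R n m) :
  valid_profile v -> 0 <= scale v.
Proof.
move=> hv; apply: sumr_ge0 => j _.
exact: (valuation_ge0 (submodular_welfare hv)).
Qed.

Lemma submodular_scaled (R : realType) n m lam (v : profile R n m) :
  0 <= lam -> valid_profile v -> submodular_valuation (scaled lam v).
Proof.
move=> lam0 hv; apply: submodular_valuationZ; last exact: submodular_welfare.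
by rewrite divr_ge0 ?scale_ge0.
Qed.

Lemma sum_singletons (R : realType) n m (v : profile R n m) :
  \sum_(q <- singletons n m) v q.1 q.2 = scale v.
Proof.
by rewrite /singletons big_allpairs_dep big_enum exchange_big /= big_enum.
Qed.

(** The coins of [M] are kept, so the law of the outcome is exactly the lottery that [M] assigns to
    the scaled report. *)
Definition scaled_mechanism (R : realType) m (lam : R) (M : mechanism R 1 m)
    (n : nat) : mechanism R n m :=
  Mechanism (coin_law M) (fun w => ask_sum (singletons n m) 0 (fun s =>
    simulate n (lam / s) (fun x => (x.1, fun=> 0)) (algo w))).

Lemma alloc_scaled (R : realType) n m lam (M : mechanism R 1 m)
    (v : profile R n m) (w : coins M) :
  @alloc _ _ _ (scaled_mechanism lam M n) v w = alloc (single (scaled lam v)) w.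
Proof.
by rewrite /alloc /= run_ask_sum run_simulate add0r sum_singletons.
Qed.

Lemma payment_scaled (R : realType) n m lam (M : mechanism R 1 m)
    (v : profile R n m) i :
  @payment _ _ _ (scaled_mechanism lam M n) v i = cst 0.
Proof.
by apply/funext => w; rewrite /payment /= run_ask_sum run_simulate.
Qed.

Lemma queries_scaled (R : realType) m lam (M : mechanism R 1 m) q : 0 <= lam ->
  queries_at_most M q -> queries_at_most (scaled_mechanism lam M 1) (q + m).
Proof.
move=> lam0 hq v hv w; rewrite /= nqueries_ask_sum nqueries_simulate.
rewrite size_allpairs !size_enum_ord mul1n addnC leq_add2r.
(* The query bound for [M] covers valid reports only; the scaled report is one. *)
apply: hq; rewrite add0r sum_singletons.
exact/valid_single/submodular_scaled.
Qed.

(** * Finite nets and bounds on suprema *)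

(* Total boundedness of a cube, with one representative for each cell of a grid
   of mesh [1 / N]; [B] bounds the finitely many values [p t']. *)
Lemma finite_net (R : realType) (T : Type) (I : finType) (Q : T -> Prop)
    (D : T -> I -> R) (p : T -> R) (tol : R) :
  0 < tol -> (forall t, Q t -> forall i, 0 <= D t i <= 1) ->
  exists B, 0 <= B /\ forall t, Q t -> exists t', [/\ Q t', p t' <= B &
    forall i, D t i <= D t' i + tol].
Proof.
move=> tol0 D01.
pose N := (Num.truncn tol^-1).+1.
(* There are [N + 1] indices per coordinate, since the value 1 falls into cell [N]. *)
pose cell t : {ffun I -> 'I_N.+1} :=
  [ffun i => inord (Num.truncn (N%:R * D t i))].
(* One representative is fixed for each inhabited cell; empty cells get the default 0. *)
have /choice[p' hp'] : forall x, exists y, (exists t, Q t /\ cell t = x) ->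
    exists t, [/\ Q t, cell t = x & p t = y].
  move=> x.
  have [[t [Qt <-]]|no] := pselect (exists t, Q t /\ cell t = x).
    by exists (p t) => _; exists t.
  by exists 0 => /no.
exists (\sum_x `|p' x|); split; first by apply: sumr_ge0.
move=> t Qt; have [|t' [Qt' ct' pt']] := hp' (cell t); first by exists t.
exists t'; split => //.
  rewrite pt' (le_trans (ler_norm _)) // (bigD1 (cell t)) //= lerDl.
  exact: sumr_ge0.
move=> i.
have truncn_bound u : Q u -> (Num.truncn (N%:R * D u i) < N.+1)%N.
  move=> Qu; have /andP[u0 u1] := D01 u Qu i.
  rewrite truncn_lt_nat ?mulr_ge0 // (le_lt_trans (y := N%:R)) ?ltr_nat //.
  by rewrite ler_piMr.
have /ffunP/(_ i) := ct'; rewrite !ffunE => /(congr1 val).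
rewrite /= !inordK ?truncn_bound // => etr.
have /andP[t0 _] := D01 t Qt i; have /andP[t'0 _] := D01 t' Qt' i.
have /andP[_ h1] := truncn_itv (mulr_ge0 (ler0n R N) t0).
have /andP[h2 _] := truncn_itv (mulr_ge0 (ler0n R N) t'0).
(* Points of the same cell differ by less than [1 / N] in each coordinate, and [1 / N <= tol]. *)
move: h1 h2; rewrite -natr1 etr => h1 h2.
have Ntol : 1 <= N%:R * tol.
  by rewrite -ler_pdivrMr // div1r ltW // truncnS_gt.
have N0 : 0 < N%:R :> R by rewrite ltr0n.
rewrite -(ler_pM2l N0) mulrDr; lra.
Qed.

(** The sign of [a] is left open because the factor [1 - (3 * eps + delta)] may be negative. *)
Lemma scale_sup_le (R : realType) (A : set R) (a x : R) :
  A !=set0%classic -> 0 <= x -> (forall y, A y -> 0 <= y) ->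
  (forall y, A y -> a * y <= x) -> a * sup A <= x.
Proof.
move=> A0 x0 Age0 aAx; have [a0|a0] := ltP 0 a.
  rewrite mulrC -ler_pdivlMr //; apply: ge_sup => // y Ay.
  by rewrite ler_pdivlMr // mulrC; exact: aAx.
(* For [a <= 0] it suffices that [sup A] is non-negative, which also holds for its default value
   0. *)
apply: le_trans x0; rewrite mulr_le0_ge0 //.
have [hs|/sup_out->] := pselect (has_sup A); last by [].
by have [y Ay] := A0; apply: le_trans (Age0 y Ay) (ub_le_sup hs.2 Ay).
Qed.

(** * The menu of a one-player mechanism: lotteries and expected prices *)

(** For [u = welfare v] this is convertible with [expected_welfare v D]. *)
Definition value (R : realType) m (D u : {set 'I_m} -> R) : R :=
  \sum_S D S * u S.

Lemma valueZ (R : realType) m (D u : {set 'I_m} -> R) a :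
  value D (fun S => a * u S) = a * value D u.
Proof. by rewrite /value mulr_sumr; apply: eq_bigr => S _; rewrite mulrCA. Qed.

Definition lottery (R : realType) m (M : mechanism R 1 m)
    (v : {set 'I_m} -> R) (S : {set 'I_m}) : R :=
  fine (coin_law M [set w | alloc (single v) w = S]%classic).

Definition price (R : realType) m (M : mechanism R 1 m)
    (v : {set 'I_m} -> R) : R :=
  fine ('E_(coin_law M)[@payment _ _ _ M (single v) ord0])%E.

Lemma lottery_ge0 (R : realType) m (M : mechanism R 1 m) v S :
  0 <= lottery M v S.
Proof. by apply: fine_ge0; exact: measure_ge0. Qed.

Lemma lottery_le1 (R : realType) b m k (M : mechanism R 1 m) v S :
  mechanism_ok b k M -> submodular_valuation v -> lottery M v S <= 1.
Proof.
move=> hM hv; rewrite -lee_fin fineK; last first.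
  rewrite fin_num_measure //; apply: alloc_measurable hM _ _ _.
  exact: valid_single.
apply: probability_le1; apply: alloc_measurable hM _ _ _.
exact: valid_single.
Qed.

Lemma lotteryE (R : realType) b m k (M : mechanism R 1 m) v S :
  mechanism_ok b k M -> submodular_valuation v ->
  coin_law M [set w | alloc (single v) w = S]%classic = (lottery M v S)%:E.
Proof.
move=> hM hv; rewrite fineK // fin_num_measure //.
by apply: alloc_measurable hM _ _ _; exact: valid_single.
Qed.

Lemma expectation_alloc (R : realType) b m k (M : mechanism R 1 m) v u :
  mechanism_ok b k M -> submodular_valuation v ->
  ('E_(coin_law M)[fun w => u (alloc (single v) w)] =
    (value (lottery M v) u)%:E)%E.
Proof.
move=> hM hv; apply: (expectation_finite_rv _ (X := alloc (single v)) _ u).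
by apply: alloc_measurable hM _ _; exact: valid_single.
Qed.

Lemma lottery_distribution (R : realType) b m k (M : mechanism R 1 m) v :
  mechanism_ok b k M -> submodular_valuation v ->
  distribution_on (outcomes b m k) (lottery M v).
Proof.
move=> hM hv; split; first exact: lottery_ge0.
  (* The total mass is the expectation of the constant 1. *)
  have := expectation_alloc (fun=> 1) hM hv.
  rewrite [in LHS](_ : (fun _ => 1) = cst 1) // expectation_cst => -[->].
  by apply: eq_bigr => S _; rewrite mulr1.
move=> S SO; rewrite /lottery (_ : [set w | _]%classic = set0) ?measure0 //.
rewrite -subset0 => w /= eS; move: SO; rewrite -eS.
by rewrite (alloc_feasible hM (valid_single hv)).
Qed.

Lemma expected_utilityE (R : realType) b m k (M : mechanism R 1 m) u v :
  mechanism_ok b k M -> submodular_valuation v ->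
  expected_utility M u (single v) ord0 =
  (value (lottery M v) u - price M v)%:E.
Proof.
move=> hM hv; have vv := valid_single hv.
have hp := payment_integrable hM vv ord0.
rewrite /expected_utility.
rewrite [X in expectation _ X](_ : _ =
  (u \o alloc (single v)) \- @payment _ _ _ M (single v) ord0) //.
rewrite expectationB; first last.
- exact/Lfun1_integrable.
- apply/Lfun1_integrable/integrable_finite_rv; exact: alloc_measurable hM _ vv.
rewrite EFinB -(expectation_alloc u hM hv) fineK //.
by apply: expectation_fin_num; exact/Lfun1_integrable.
Qed.

Lemma price_ge0 (R : realType) b m k (M : mechanism R 1 m) v :
  mechanism_ok b k M -> submodular_valuation v -> 0 <= price M v.
Proof.
by move=> hM hv; apply: fine_ge0; exact: payment_ge0 hM _ (valid_single hv) _.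
Qed.

Lemma truthful_menu (R : realType) b m k eps (M : mechanism R 1 m) u v :
  mechanism_ok b k M -> approx_truthful eps M ->
  submodular_valuation u -> submodular_valuation v ->
  (1 - eps) * (value (lottery M v) u - price M v) <= value (lottery M u) u.
Proof.
move=> hM hT hu hv; have := hT _ ord0 v (valid_single hu) hv.
rewrite (_ : deviate _ _ _ = single v); last first.
  by apply/funext => i; rewrite /deviate (ord1 i) eqxx.
rewrite !(expected_utilityE _ hM) // -EFinM lee_fin => /le_trans; apply.
by rewrite gerBl; exact: price_ge0 hM hu.
Qed.

(** * Near-optimality of the scaled report, with an additive error *)

(** In units of [v], a price at most [B] weighs [B * s / lam], which is at most [tol / 2 * s] for
    large [lam]. Replacing [w] by a representative of the net costs the other [tol / 2 * s]. The net
    does not depend on [v] or [w], so neither does [lam]. *)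
Lemma scaled_report_additive (R : realType) b m k eps (M : mechanism R 1 m)
    (tol : R) : mechanism_ok b k M -> approx_truthful eps M -> eps <= 1 ->
  0 < tol -> exists lam, 0 < lam /\ forall v w,
    submodular_valuation v -> submodular_valuation w ->
    let s := \sum_j v [set j]%SET in 0 < s ->
    (1 - eps) * (value (lottery M w) v - tol * s) <=
      value (lottery M (fun S => lam / s * v S)) v.
Proof.
move=> hM hT eps1 tol0.
pose N : R := #|{set 'I_m}|%:R.
have N0 : 0 < N by rewrite ltr0n; apply/card_gt0P; exists finset.set0.
(* Each of the [N] coordinates contributes an error of at most [tol / 2 / N] times [v S <= s]. *)
have [||B [B0 hB]] := @finite_net R _ _ (@submodular_valuation R m) (lottery M)
  (price M) (tol / 2 / N).
- by rewrite !divr_gt0.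
- by move=> t ht S; rewrite lottery_ge0 (lottery_le1 S hM ht).
(* The second summand gives [B <= tol / 2 * lam]; the 1 keeps [lam] positive when [B = 0]. *)
exists (1 + B * 2 / tol).
have lam0 : 0 < 1 + B * 2 / tol.
  by rewrite ltr_pwDl // !mulr_ge0 // invr_ge0 ltW.
split => // v w hv hw s s0.
set lam := 1 + _ in lam0 *.
have [t [ht pt dt]] := hB w hw.
have ls0 : 0 < lam / s by rewrite divr_gt0.
have hu := submodular_valuationZ (ltW ls0) hv.
have := truthful_menu hM hT hu ht.
rewrite !valueZ => tm.
(* The comparison is made in the utility of the scaled report; then [1 - eps >= 0] cancels. *)
rewrite -(ler_pM2l ls0); apply: le_trans tm.
rewrite mulrCA ler_wpM2l ?subr_ge0 // mulrBr.
have vw : value (lottery M w) v <= value (lottery M t) v + tol / 2 * s.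
  apply: (@le_trans _ _ (\sum_S (lottery M t S * v S + tol / 2 / N * s))).
    apply: ler_sum => S _.
    apply: (@le_trans _ _ ((lottery M t S + tol / 2 / N) * v S)).
      by rewrite ler_wpM2r // (valuation_ge0 hv).
    rewrite mulrDl lerD2l ler_wpM2l //; last exact: valuation_le_singletons.
    by rewrite !divr_ge0 // ltW.
  rewrite big_split /= lerD2l sumr_const -[leLHS]mulr_natr.
  by rewrite mulrAC divfK // gt_eqF.
apply: le_trans (lerB (ler_wpM2l (ltW ls0) vw) (lexx _)) _.
rewrite mulrDr -addrA lerD2l.
have -> : lam / s * (tol / 2 * s) - lam / s * (tol * s) = - (tol / 2 * lam).
  by field; rewrite gt_eqF.
rewrite lerN2; apply: le_trans pt _.
rewrite mulrDr (_ : tol / 2 * (B * 2 / tol) = B).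
  by rewrite lerDr mulr1 divr_ge0 // ltW.
by field; rewrite gt_eqF.
Qed.

(** * Scale, optimal welfare and degenerate cases *)

Lemma le_opt_welfare (R : realType) b n m k (v : profile R n m) S :
  S \in outcomes b m k -> welfare v S <= opt_welfare b k v.
Proof. by move=> SO; apply: (le_bigmax_cond 0 (welfare v)). Qed.

Lemma opt_welfareZ (R : realType) b n m k (v : profile R n m) a : 0 <= a ->
  opt_welfare b k (single (fun S => a * welfare v S)) = a * opt_welfare b k v.
Proof.
move=> a0; rewrite /opt_welfare.
rewrite (big_morph (fun x => a * x) (fun x y => maxr_pMr x y a0) (mulr0 a)).
by apply: eq_bigr => S _; rewrite /welfare big_ord1.
Qed.

(** Listing [j] first and keeping [k] elements gives a set of size exactly [k], an outcome in both
    variants. *)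
Lemma outcome_containing b m k (j : 'I_m) : (0 < k <= m)%N ->
  exists2 S, S \in outcomes b m k & j \in S.
Proof.
case/andP; case: k => // k _ km.
pose s := take k.+1 (j :: rem j (enum 'I_m)).
have us : uniq s.
  rewrite take_uniq //= rem_uniq ?enum_uniq // andbT.
  by rewrite mem_rem_uniq ?enum_uniq // !inE eqxx.
have cS : #|[set x in s]%SET| = k.+1.
  rewrite cardsE (card_uniqP us) size_takel //= size_rem ?mem_enum //.
  by rewrite size_enum_ord; case: (m) km j {s us}.
exists [set x in s]%SET; last by rewrite inE mem_head.
by case: b; rewrite inE cS.
Qed.

Lemma scale_le_opt (R : realType) b n m k (v : profile R n m) :
  valid_profile v -> (0 < k <= m)%N -> scale v <= m%:R * opt_welfare b k v.
Proof.
move=> hv km; rewrite -[m in m%:R]card_ord -sum1_card natr_sum mulr_suml.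
apply: ler_sum => j _; rewrite mul1r.
have [S SO jS] := outcome_containing b j km.
apply: le_trans (le_opt_welfare v SO).
by apply: (valuation_monotone (submodular_welfare hv)); rewrite finset.sub1set.
Qed.

Lemma value_ge0 (R : realType) m (D u : {set 'I_m} -> R) :
  (forall S, 0 <= D S) -> (forall S, 0 <= u S) -> 0 <= value D u.
Proof. by move=> D0 u0; apply: sumr_ge0 => S _; rewrite mulr_ge0. Qed.

Lemma welfare_scale0 (R : realType) n m (v : profile R n m) S :
  valid_profile v -> scale v = 0 -> welfare v S = 0.
Proof.
move=> hv s0; have sv := submodular_welfare hv; apply/eqP.
by rewrite eq_le (valuation_ge0 sv) andbT -[leRHS]s0 valuation_le_singletons.
Qed.

(** Both sides of the guarantee are homogeneous in the valuation, so the guarantee of [M] at the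
    scaled report is divided by [lam / scale v]. If the scale is 0, all welfare vanishes. *)
Lemma value_scaled_approx (R : realType) b n m k c lam (M : mechanism R 1 m)
    (v : profile R n m) : 0 < lam -> 0 <= c ->
  mechanism_ok b k M -> approximates b k c M -> valid_profile v ->
  c * opt_welfare b k v <= value (lottery M (scaled lam v)) (welfare v).
Proof.
move=> lam0 c0 hM hA hv.
have hu := submodular_scaled (ltW lam0) hv.
have := scale_ge0 hv; rewrite le_eqVlt => /predU1P[/esym s0|s0].
  apply: (@le_trans _ _ 0).
    rewrite mulr_ge0_le0 //; apply: bigmax_le => // S _.
    by rewrite welfare_scale0.
  by apply: value_ge0 => S; rewrite ?lottery_ge0 ?welfare_scale0.
have ls0 : 0 < lam / scale v by rewrite divr_gt0.
have := hA _ (valid_single hu).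
rewrite (_ : (fun w => _) =
  (fun w => scaled lam v (alloc (single (scaled lam v)) w))); last first.
  by apply/funext => w; rewrite /welfare big_ord1.
rewrite (expectation_alloc _ hM hu) lee_fin (opt_welfareZ _ _ _ (ltW ls0)).
by rewrite [in leRHS]valueZ mulrCA ler_pM2l.
Qed.

Lemma value_empty_budget (R : realType) b n m (v : profile R n m) D :
  valid_profile v -> distribution_on (outcomes b m 0) D ->
  value D (welfare v) = 0.
Proof.
move=> hv [D0 D1 Ds]; apply: big1 => S _.
have [->|S0] := eqVneq S finset.set0.
  by rewrite (valuation_normalized (submodular_welfare hv)) mulr0.
rewrite Ds ?mul0r //; apply: contra S0.
by case: b {Ds}; rewrite inE ?leqn0 cards_eq0.
Qed.

Lemma value_scale0 (R : realType) n m (v : profile R n m) D :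
  valid_profile v -> scale v = 0 -> value D (welfare v) = 0.
Proof. by move=> hv s0; apply: big1 => S _; rewrite welfare_scale0 ?mulr0. Qed.

(** * From the additive to the multiplicative error *)

Lemma scaled_report_approx_optimal (R : realType) b m k eps c
    (M : mechanism R 1 m) (delta : R) : (k <= m)%N -> 0 <= eps -> 0 < c -> 0 < delta ->
  mechanism_ok b k M -> approx_truthful eps M -> approximates b k c M ->
  exists lam, 0 < lam /\ forall n (v : profile R n m) w, valid_profile v ->
    submodular_valuation w ->
    (1 - (3 * eps + delta)) * value (lottery M w) (welfare v) <=
      value (lottery M (scaled lam v)) (welfare v).
Proof.
move=> km eps0 c0 delta0 hM hT hA.
have value0 D n (v : profile R n m) : (forall S, 0 <= D S) -> valid_profile v ->
    0 <= value D (welfare v).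
  move=> D0 hv; apply: value_ge0 => // S.
  exact: (valuation_ge0 (submodular_welfare hv)).
(* For [eps > 1] the factor on the left is negative, so any [lam] works; for [k = 0] every lottery
   has value 0. *)
have [eps1|eps1] := leP eps 1; last first.
  exists 1; split => // n v w hv hw.
  apply: (@le_trans _ _ 0); last exact: (value0 _ _ _ (lottery_ge0 _ _)).
  rewrite mulr_le0_ge0 ?value0 //; last exact: lottery_ge0.
  lra.
have [k0|k0] := posnP k.
  exists 1; split => // n v w hv hw; rewrite k0 in hM hA.
  have hu := submodular_scaled (ler01 : 0 <= 1 :> R) hv.
  rewrite (value_empty_budget hv (lottery_distribution hM hw)) mulr0.
  exact: (value0 _ _ _ (lottery_ge0 _ _)).
have m0 : 0 < m%:R :> R by rewrite ltr0n (leq_trans k0).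
(* With this tolerance the error [tol * scale v] is at most [delta * c * O], where [O] is the
   optimum, and hence at most [delta] times the welfare obtained. *)
have [|lam [lam0 hlam]] := @scaled_report_additive R b m k eps M
    (delta * c / m%:R) hM hT eps1.
  by rewrite divr_gt0 // mulr_gt0.
exists lam; split => // n v w hv hw.
have := scale_ge0 hv; rewrite le_eqVlt => /predU1P[/esym s0|s0].
  by rewrite !value_scale0 ?mulr0.
have := hlam _ w (submodular_welfare hv) hw s0.
rewrite -/(scale v) -/(scaled lam v).
have := value_scaled_approx lam0 (ltW c0) hM hA hv.
have := @scale_le_opt R b n m k v hv; rewrite k0 km => /(_ isT).
set X := value _ _; set Y := value _ _; set O := opt_welfare b k v => sO OX XY.
have Y0 : 0 <= Y by apply: value0 => //; exact: lottery_ge0.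
have dc0 : 0 <= delta * c / m%:R by rewrite ltW // divr_gt0 // mulr_gt0.
have tolX : delta * c / m%:R * scale v <= delta * X.
  apply: (le_trans (ler_wpM2l dc0 sO)).
  have -> : delta * c / m%:R * (m%:R * O) = delta * (c * O).
    by field; rewrite gt_eqF.
  by rewrite ler_pM2l.
have tol0 : 0 <= delta * c / m%:R * scale v by rewrite mulr_ge0 // ltW.
move: (delta * c / m%:R * scale v) tolX tol0 XY => t tX t0 XY.
have epsY : 0 <= eps * Y by rewrite mulr_ge0.
have epst : 0 <= eps * t by rewrite mulr_ge0.
(* If [Y <= X], the factor on the left is at most 1. Otherwise [t <= delta * X <= delta * Y] turns
   the error into a multiple of [Y]. *)
have [YX|XltY] := leP Y X.
  have : 0 <= delta * Y by rewrite mulr_ge0 // ltW.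
  lra.
have : delta * X <= delta * Y by rewrite ler_pM2l // ltW.
lra.
Qed.

(** * Guarantees and range of the scaled mechanism *)

Lemma scaled_mechanism_ok (R : realType) b n m k lam (M : mechanism R 1 m) :
  0 < lam -> mechanism_ok b k M ->
  mechanism_ok b k (scaled_mechanism lam M n).
Proof.
move=> lam0 hM; split => v hv.
- move=> w; rewrite alloc_scaled; apply: alloc_feasible hM _ _ _.
  exact/valid_single/submodular_scaled/hv/ltW.
- move=> S; under eq_set do rewrite alloc_scaled.
  apply: alloc_measurable hM _ _ _.
  exact/valid_single/submodular_scaled/hv/ltW.
- move=> i; rewrite payment_scaled; exact: integrable0.
- move=> i; apply: expectation_ge0 => w; rewrite payment_scaled subr0.
  exact: valuation_ge0.
- by move=> i; apply: expectation_ge0 => w; rewrite payment_scaled.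
Qed.

Lemma scaled_mechanism_approximates (R : realType) b n m k c lam
    (M : mechanism R 1 m) : 0 < lam -> 0 <= c ->
  mechanism_ok b k M -> approximates b k c M ->
  approximates b k c (scaled_mechanism lam M n).
Proof.
move=> lam0 c0 hM hA v hv.
under eq_fun do rewrite alloc_scaled.
rewrite (expectation_alloc _ hM (submodular_scaled (ltW lam0) hv)) lee_fin.
exact: value_scaled_approx.
Qed.

Theorem theorem4p1 (R : realType) (b : variant) (eps : R) (c : nat -> R)
    (heps : 0 <= eps) (hc : forall m : nat, 0 < c m)
    (M : forall m k n : nat, mechanism R n m)
    (hM : forall m k n : nat, (k <= m)%N -> (0 < n)%N ->
       [/\ mechanism_ok b k (M m k n),
           approx_truthful eps (M m k n)
         & approximates b k (c m) (M m k n)])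
    (delta : R) (hdelta : 0 < delta) :
  exists M' : forall m k n : nat, mechanism R n m,
    forall m k : nat, (k <= m)%N ->
      [/\ approx_midr b k (3 * eps + delta) (M' m k),
          forall n : nat, (0 < n)%N ->
            mechanism_ok b k (M' m k n) /\ approximates b k (c m) (M' m k n)
        & forall q : nat, queries_at_most (M m k 1%N) q ->
            queries_at_most (M' m k 1%N) (q + m)].
Proof.
(* Non-uniformity enters here: [lam] is chosen for each pair [(m, k)], before the number of players
   and the valuations; it is junk for [k > m]. *)
have /choice[lam hlam] : forall mk : nat * nat, exists lam, (mk.2 <= mk.1)%N ->
    0 < lam /\ forall n (v : profile R n mk.1) w, valid_profile v ->
    submodular_valuation w ->
    (1 - (3 * eps + delta)) * value (lottery (M mk.1 mk.2 1%N) w) (welfare v) <=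
      value (lottery (M mk.1 mk.2 1%N) (scaled lam v)) (welfare v).
  case=> m k /=; have [km|] := leqP k m; last by exists 0.
  have [hok hT hA] := hM m k 1%N km isT.
  have [lam hlam] :=
    scaled_report_approx_optimal km heps (hc m) hdelta hok hT hA.
  by exists lam.
exists (fun m k n => scaled_mechanism (lam (m, k)) (M m k 1%N) n) => m k km.
have [hok hT hA] := hM m k 1%N km isT.
have [/= lam0 hopt] := hlam (m, k) km.
split; last first.
- by move=> q; apply: queries_scaled; exact: ltW.
- move=> n n0; split; first exact: scaled_mechanism_ok.
  by apply: scaled_mechanism_approximates => //; exact: ltW.
(* The lotteries are indexed by all one-player reports, so the range refers neither to [n] nor to
   the profile. *)
exists [set lottery (M m k 1%N) w | w in @submodular_valuation R m]%classic.
split=> [D [w hw <-]|n v n0 hv]; first exact: lottery_distribution.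
have hu := submodular_scaled (ltW lam0) hv.
exists (lottery (M m k 1%N) (scaled (lam (m, k)) v)); split.
- by exists (scaled (lam (m, k)) v).
- move=> S; under eq_set do rewrite alloc_scaled.
  exact: lotteryE hok hu.
have lot_ge0 w : 0 <= value (lottery (M m k 1%N) w) (welfare v).
  apply: value_ge0; first exact: lottery_ge0.
  exact: (valuation_ge0 (submodular_welfare hv)).
apply: scale_sup_le => [|||]; last first.
- by move=> _ [_ [w hw <-] <-]; exact: hopt.
- by move=> _ [_ [w hw <-] <-]; exact: lot_ge0.
- exact: lot_ge0.
- eexists; exists (lottery (M m k 1%N) (scaled (lam (m, k)) v)) => //.
  by exists (scaled (lam (m, k)) v).
Qed.
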